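(* Let $F$ and $G$ be two noetherian forms over the same category, both having an exact join decomposition. Let $F_c,G_c$ denote the subforms of conormal clusters and $F_n,G_n$ the subforms of normal clusters of $F$ and $G$. There are isomorphisms $F_c\cong G_c$ and $F_n\cong G_n$ if and only if there is an isomorphism $F\cong G$.
   Context: Forms. A form over a category $\mathbb{C}$ is a faithful functor $F\colon\mathbb{B}\to\mathbb{C}$ that is amnestic (an isomorphism of $\mathbb{B}$ sent to an identity morphism is an identity morphism). Objects of $\mathbb{B}$ sent to $X$ are called ($F$-)clusters in $X$. For $f\colon X\to Y$, a cluster $A$ in $X$ and a cluster $B$ in $Y$, $B\geq_f A$ means that some morphism $A\to B$ of $\mathbb{B}$ is sent to $f$; $\geq$ denotes $\geq_{1_X}$, a partial order on the clusters in $X$. $F$ is orean if: (O1) for each $X$ the clusters in $X$ form a bounded lattice ($\bot_X,\top_X,\vee,\wedge$); (O2) for $f\colon X\to Y$, $g\colon Y\to Z$, if $C\geq_{gf}A$ then there is a cluster $B$ in $Y$ with $C\geq_g B$ and $B\geq_f A$; (O3) for $f\colon X\to Y$ and a cluster $S$ in $X$ there is a least cluster $f\cdot S$ in $Y$ among those $T$ with $T\geq_f S$, and for a cluster $T$ in $Y$ there is a largest cluster $T\cdot f$ in $X$ among those $S$ with $T\geq_f S$. For $f\colon X\to Y$ put $\mathrm{Im} f=f\cdot\top_X$, $\mathrm{Ker} f=\bot_Y\cdot f$. A cluster is conormal (normal) if it is the image (kernel) of some morphism. An orean form is conormal (normal) if all its clusters are. Operators. An operator $\tau\colon F\to G$ between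 forms over $\mathbb{C}$ is a functor between the domains with $G\circ\tau=F$; equivalently, a map of clusters over each object such that $B\geq_f A$ implies $\tau B\geq_f\tau A$. Isomorphisms of forms are invertible operators. A collection of $F$-clusters, with the relations $\geq_f$ restricted, is a subform of $F$. For an idempotent operator $\tau\colon F\to F$, $F_\tau$ is the subform of clusters $S$ with $\tau S=S$. An operator of orean forms is conormal if $\tau(\mathrm{Im}^F f)=\mathrm{Im}^G f$ for all $f$, normal if $\tau(\mathrm{Ker}^F f)=\mathrm{Ker}^G f$ for all $f$, binormal if both. Noetherian forms. For an orean form, an embedding of a conormal cluster $S$ in $X$ is a morphism $m\colon W\to X$ with $\mathrm{Im}\, m=S$ such that every $m'\colon W'\to X$ with $\mathrm{Im}\, m'\leq S$ factors uniquely as $m'=mg$. A quotient of a normal cluster $S$ in $X$ is a morphism $q\colon X\to Y$ with $\mathrm{Ker}\, q=S$ such that every $q'\colon X\to Y'$ with $\mathrm{Ker}\, q'\geq S$ factors uniquely as $q'=hq$. An orean form is noetherian if: (N1) for every $f\colon X\to Y$, $(f\cdot S)\cdot f=S\vee\mathrm{Ker} f$ for all clusters $S$ in $X$, and $f\cdot(T\cdot f)=T\wedge\mathrm{Im} f$ for all clusters $T$ in $Y$; (N2) every morphism $f$ factors as $f=me$ with $m$ an embedding of $\mathrm{Im} f$ and $e$ a quotient of $\mathrm{Ker} f$; (N3) the join of two normal clusters is normal and the meet of two conormal clusters is conormal. Exact join decomposition. A join decomposition of an orean form $F$ is a pair $(\kappa_s,\kappa_e)$ of idempotent operators $F\to F$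 such that $F_s=F_{\kappa_s}$ is a conormal orean form, $F_e=F_{\kappa_e}$ is a normal orean form, and $S=\kappa_s S\vee\kappa_e S$ for every cluster $S$. It is exact if the restrictions $\tau_s\colon F\to F_s$, $\tau_e\colon F\to F_e$ of $\kappa_s,\kappa_e$ are binormal, there exist a conormal operator $F_s\to F_e$ and a normal operator $F_e\to F_s$, the subform inclusion $F_s\to F$ is conormal and the subform inclusion $F_e\to F$ is normal. *)

(* Defs.v *)
From Stdlib Require Import ProofIrrelevance.

Set Implicit Arguments.
Unset Strict Implicit.
Unset Printing Implicit Defensive.

Record category : Type := Category {
  ob :> Type;
  hom : ob -> ob -> Type;
  idm : forall X, hom X X;
  comp : forall X Y Z, hom Y Z -> hom X Y -> hom X Z;
  comp_idl : forall X Y (f : hom X Y), comp (idm Y) f = f;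
  comp_idr : forall X Y (f : hom X Y), comp f (idm X) = f;
  comp_assoc : forall X Y Z W (h : hom Z W) (g : hom Y Z) (f : hom X Y),
    comp h (comp g f) = comp (comp h g) f
}.
Arguments hom {c} X Y.
Arguments idm {c} X.
Arguments comp {c X Y Z} g f.
Notation "g ∘ f" := (comp g f) (at level 40, left associativity).

(* Equality of arrows whose endpoints need not be syntactically the same:
   [hom_eq f g] forces equal sources, equal targets, and then [f = g]. *)
Inductive hom_eq (C : category) (X Y : C) (f : hom X Y) :
    forall X' Y' : C, hom X' Y' -> Prop :=
  hom_eq_refl : hom_eq f f.

Inductive is_identity (C : category) : forall X Y : C, hom X Y -> Prop :=
  is_identity_idm : forall X : C, is_identity (idm X).

Definition is_iso (C : category) (X Y : C) (f : hom X Y) : Prop :=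
  exists g : hom Y X, g ∘ f = idm X /\ f ∘ g = idm Y.

Record functor (C D : category) : Type := Functor {
  fob :> C -> D;
  fmap : forall X Y : C, hom X Y -> hom (fob X) (fob Y);
  fmap_id : forall X, fmap (idm X) = idm (fob X);
  fmap_comp : forall X Y Z (g : hom Y Z) (f : hom X Y),
    fmap (g ∘ f) = fmap g ∘ fmap f
}.
Arguments fmap {C D} _ {X Y} f.

Definition functor_eq (C D : category) (H K : functor C D) : Prop :=
  (forall X, H X = K X) /\
  (forall X Y (f : hom X Y), hom_eq (fmap H f) (fmap K f)).

Definition functor_id (C : category) : functor C C :=
  @Functor C C (fun X => X) (fun X Y f => f)
    (fun X => eq_refl) (fun X Y Z g f => eq_refl).

Definition functor_comp (C D E : category) (K : functor D E) (H : functor C D) :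
  functor C E.
Proof.
refine (@Functor C E (fun X => K (H X)) (fun X Y f => fmap K (fmap H f)) _ _).
- intros X. now rewrite fmap_id, fmap_id.
- intros X Y Z g f. now rewrite fmap_comp, fmap_comp.
Defined.

Definition full_subcategory (B : category) (P : B -> Prop) : category :=
  @Category {A : B | P A}
    (fun A A' => @hom B (proj1_sig A) (proj1_sig A'))
    (fun A => @idm B (proj1_sig A))
    (fun _ _ _ g f => @comp B _ _ _ g f)
    (fun _ _ f => @comp_idl B _ _ f)
    (fun _ _ f => @comp_idr B _ _ f)
    (fun _ _ _ _ h g f => @comp_assoc B _ _ _ _ h g f).

Definition full_subcategory_incl (B : category) (P : B -> Prop) :
  functor (full_subcategory P) B :=
  @Functor (full_subcategory P) B
    (fun A => proj1_sig A) (fun _ _ f => f)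
    (fun _ => eq_refl) (fun _ _ _ _ _ => eq_refl).

Record form (C : category) : Type := Form {
  dom : category;
  proj :> functor dom C;
  form_faithful : forall (A B : dom) (h h' : hom A B),
    fmap proj h = fmap proj h' -> h = h';
  form_amnestic : forall (A B : dom) (h : hom A B),
    is_iso h -> is_identity (fmap proj h) -> is_identity h
}.

Record cluster (C : category) (F : form C) (X : C) : Type := Cluster {
  cl_ob : dom F;
  cl_over : F cl_ob = X
}.
Arguments Cluster {C F X} _ _.

Lemma cluster_eq (C : category) (F : form C) (X : C) (S T : cluster F X) :
  cl_ob S = cl_ob T -> S = T.
Proof.
destruct S as [A e], T as [B e']; simpl; intros H; subst B.
now rewrite (proof_irrelevance _ e e').
Qed.

Definition geq (C : category) (F : form C) (X Y : C) (f : hom X Y)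
    (B : cluster F Y) (A : cluster F X) : Prop :=
  exists h : hom (cl_ob A) (cl_ob B), hom_eq (fmap F h) f.

Notation "B >=[ f ] A" := (geq f B A)
  (at level 70, f at level 200, no associativity).

Definition ge (C : category) (F : form C) (X : C) (B A : cluster F X) : Prop :=
  B >=[ idm X ] A.

(* The operations below are uniquely determined by [F], since [ge] is
   antisymmetric; carrying them as data costs no generality. *)
Record orean (C : category) (F : form C) : Type := Orean {
  bot : forall X, cluster F X;
  top : forall X, cluster F X;
  join : forall X, cluster F X -> cluster F X -> cluster F X;
  meet : forall X, cluster F X -> cluster F X -> cluster F X;
  dimg : forall X Y, hom X Y -> cluster F X -> cluster F Y;
  iimg : forall X Y, cluster F Y -> hom X Y -> cluster F X;
  bot_least : forall X (S : cluster F X), ge S (bot X);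
  top_greatest : forall X (S : cluster F X), ge (top X) S;
  join_ubl : forall X (S T : cluster F X), ge (join S T) S;
  join_ubr : forall X (S T : cluster F X), ge (join S T) T;
  join_lub : forall X (S T U : cluster F X), ge U S -> ge U T -> ge U (join S T);
  meet_lbl : forall X (S T : cluster F X), ge S (meet S T);
  meet_lbr : forall X (S T : cluster F X), ge T (meet S T);
  meet_glb : forall X (S T U : cluster F X), ge S U -> ge T U -> ge (meet S T) U;
  geq_factor : forall X Y Z (f : hom X Y) (g : hom Y Z)
      (A : cluster F X) (D : cluster F Z),
    D >=[ g ∘ f ] A -> exists B : cluster F Y, D >=[ g ] B /\ B >=[ f ] A;
  dimg_geq : forall X Y (f : hom X Y) (S : cluster F X), dimg f S >=[ f ] S;
  dimg_least : forall X Y (f : hom X Y) (S : cluster F X) (T : cluster F Y),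
    T >=[ f ] S -> ge T (dimg f S);
  iimg_geq : forall X Y (f : hom X Y) (T : cluster F Y), T >=[ f ] iimg T f;
  iimg_greatest : forall X Y (f : hom X Y) (T : cluster F Y) (S : cluster F X),
    T >=[ f ] S -> ge (iimg T f) S
}.
Arguments bot {C F} o X.
Arguments top {C F} o X.
Arguments join {C F} o {X} S T.
Arguments meet {C F} o {X} S T.
Arguments dimg {C F} o {X Y} f S.
Arguments iimg {C F} o {X Y} T f.

Section OreanForm.
Variables (C : category) (F : form C) (oF : orean F).

Definition Im X Y (f : hom X Y) : cluster F Y := dimg oF f (top oF X).
Definition Ker X Y (f : hom X Y) : cluster F X := iimg oF (bot oF Y) f.

Definition is_conormal X (S : cluster F X) : Prop :=
  exists (W : C) (f : hom W X), Im f = S.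
Definition is_normal X (S : cluster F X) : Prop :=
  exists (Y : C) (f : hom X Y), Ker f = S.

Definition conormal_form : Prop := forall X (S : cluster F X), is_conormal S.
Definition normal_form : Prop := forall X (S : cluster F X), is_normal S.

Definition is_embedding W X (m : hom W X) (S : cluster F X) : Prop :=
  Im m = S /\
  forall W' (m' : hom W' X), ge S (Im m') -> exists! g : hom W' W, m' = m ∘ g.

Definition is_quotient X Y (q : hom X Y) (S : cluster F X) : Prop :=
  Ker q = S /\
  forall Y' (q' : hom X Y'), ge (Ker q') S -> exists! h : hom Y Y', q' = h ∘ q.

Record noetherian : Prop := Noetherian {
  noeth_iimg_dimg : forall X Y (f : hom X Y) (S : cluster F X),
    iimg oF (dimg oF f S) f = join oF S (Ker f);
  noeth_dimg_iimg : forall X Y (f : hom X Y) (T : cluster F Y),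
    dimg oF f (iimg oF T f) = meet oF T (Im f);
  noeth_factor : forall X Y (f : hom X Y),
    exists (Z : C) (e : hom X Z) (m : hom Z Y),
      f = m ∘ e /\ is_embedding m (Im f) /\ is_quotient e (Ker f);
  noeth_join_normal : forall X (S T : cluster F X),
    is_normal S -> is_normal T -> is_normal (join oF S T);
  noeth_meet_conormal : forall X (S T : cluster F X),
    is_conormal S -> is_conormal T -> is_conormal (meet oF S T)
}.

End OreanForm.

Section Subform.
Variables (C : category) (F : form C) (P : forall X, cluster F X -> Prop).

Definition in_subform (A : dom F) : Prop := P (Cluster A eq_refl).

Lemma subform_amnestic (A B : full_subcategory in_subform) (h : hom A B) :
  is_iso h ->
  is_identity (fmap (functor_comp F (full_subcategory_incl in_subform)) h) ->
  is_identity h.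
Proof.
destruct A as [A p], B as [B q]; simpl in h; intros [g Hg] Hid.
assert (Hh : is_identity (h : @hom (dom F) A B)).
{ apply form_amnestic; [exists g; exact Hg | exact Hid]. }
clear g Hg Hid. revert p q.
destruct Hh as [X]; intros p q.
rewrite (proof_irrelevance _ q p).
exact (@is_identity_idm (full_subcategory in_subform) (exist _ X p)).
Qed.

Definition subform : form C :=
  @Form C (full_subcategory in_subform)
    (functor_comp F (full_subcategory_incl in_subform))
    (fun _ _ h h' => @form_faithful C F _ _ h h')
    subform_amnestic.

End Subform.

Definition conormal_part (C : category) (F : form C) (oF : orean F) : form C :=
  subform (fun X (S : cluster F X) => is_conormal oF S).

Definition normal_part (C : category) (F : form C) (oF : orean F) : form C :=
  subform (fun X (S : cluster F X) => is_normal oF S).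

Record operator (C : category) (F G : form C) : Type := Operator {
  op_fun :> functor (dom F) (dom G);
  op_over : functor_eq (functor_comp G op_fun) F
}.

Definition op_cl (C : category) (F G : form C) (t : operator F G) X
    (S : cluster F X) : cluster G X :=
  Cluster (t (cl_ob S)) (eq_trans (proj1 (op_over t) (cl_ob S)) (cl_over S)).

Definition isomorphic_forms (C : category) (F G : form C) : Prop :=
  exists (s : operator F G) (t : operator G F),
    functor_eq (functor_comp t s) (functor_id (dom F)) /\
    functor_eq (functor_comp s t) (functor_id (dom G)).

Definition idempotent_op (C : category) (F : form C) (k : operator F F) : Prop :=
  functor_eq (functor_comp k k) k.

Definition conormal_op (C : category) (F G : form C) (oF : orean F) (oG : orean G)
    (t : operator F G) : Prop :=
  forall X Y (f : hom X Y), op_cl t (Im oF f) = Im oG f.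

Definition normal_op (C : category) (F G : form C) (oF : orean F) (oG : orean G)
    (t : operator F G) : Prop :=
  forall X Y (f : hom X Y), op_cl t (Ker oF f) = Ker oG f.

Definition binormal_op (C : category) (F G : form C) (oF : orean F) (oG : orean G)
    (t : operator F G) : Prop :=
  conormal_op oF oG t /\ normal_op oF oG t.

Lemma subform_incl_over (C : category) (F : form C)
    (P : forall X, cluster F X -> Prop) :
  functor_eq (functor_comp F (full_subcategory_incl (in_subform P))) (subform P).
Proof. split; intros; constructor. Qed.

Definition subform_incl (C : category) (F : form C)
    (P : forall X, cluster F X -> Prop) : operator (subform P) F :=
  @Operator C (subform P) F (full_subcategory_incl (in_subform P))
    (subform_incl_over P).

Definition fixed_form (C : category) (F : form C) (k : operator F F) : form C :=
  subform (fun X (S : cluster F X) => op_cl k S = S).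

Lemma idempotent_fixed (C : category) (F : form C) (k : operator F F)
    (Hk : idempotent_op k) (A : dom F) :
  in_subform (fun X (S : cluster F X) => op_cl k S = S) (k A).
Proof.
apply cluster_eq. exact (proj1 Hk A).
Qed.

Definition fixed_corestr_fun (C : category) (F : form C) (k : operator F F)
    (Hk : idempotent_op k) : functor (dom F) (dom (fixed_form k)) :=
  @Functor (dom F) (dom (fixed_form k))
    (fun A => exist _ (k A) (idempotent_fixed Hk A))
    (fun _ _ h => fmap k h) (fun A => fmap_id k A)
    (fun _ _ _ g f => fmap_comp k g f).

Definition fixed_corestr (C : category) (F : form C) (k : operator F F)
    (Hk : idempotent_op k) : operator F (fixed_form k) :=
  @Operator C F (fixed_form k) (fixed_corestr_fun Hk) (op_over k).

Record join_decomposition (C : category) (F : form C) (oF : orean F) : Type :=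
  JoinDecomposition {
    kappa_s : operator F F;
    kappa_e : operator F F;
    idem_s : idempotent_op kappa_s;
    idem_e : idempotent_op kappa_e;
    orean_s : orean (fixed_form kappa_s);
    orean_e : orean (fixed_form kappa_e);
    conormal_s : conormal_form orean_s;
    normal_e : normal_form orean_e;
    join_decomp : forall X (S : cluster F X),
      S = join oF (op_cl kappa_s S) (op_cl kappa_e S)
  }.

Record exact (C : category) (F : form C) (oF : orean F)
    (D : join_decomposition oF) : Prop := Exact {
  exact_tau_s : binormal_op oF (orean_s D) (fixed_corestr (idem_s D));
  exact_tau_e : binormal_op oF (orean_e D) (fixed_corestr (idem_e D));
  exact_s_to_e : exists t : operator (fixed_form (kappa_s D)) (fixed_form (kappa_e D)),
    conormal_op (orean_s D) (orean_e D) t;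
  exact_e_to_s : exists t : operator (fixed_form (kappa_e D)) (fixed_form (kappa_s D)),
    normal_op (orean_e D) (orean_s D) t;
  exact_incl_s : conormal_op (orean_s D) oF
    (subform_incl (fun X (S : cluster F X) => op_cl (kappa_s D) S = S));
  exact_incl_e : normal_op (orean_e D) oF
    (subform_incl (fun X (S : cluster F X) => op_cl (kappa_e D) S = S))
}.

Definition has_exact_join_decomposition (C : category) (F : form C)
    (oF : orean F) : Prop :=
  exists D : join_decomposition oF, exact D.

(* Main.v *)
(** In an exact join decomposition [kappa_s S] is the largest conormal cluster
    below [S] and [kappa_e S] the largest normal one, so the two fixed forms are
    the conormal and the normal part.  Isomorphisms [alpha], [beta] of these
    parts preserve images and kernels respectively, and
    [kappa_e (alpha C) = beta (kappa_e C)] for conormal [C], because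
    [kappa_e (Im f)] is the image of [f] in the normal part.  The
    isomorphism of forms is [S |-> alpha (kappa_s S) \/ beta (kappa_e S)].  It
    is bijective because, writing [kappa_e S = Ker q], the identity
    [C \/ Ker q = (q . C) . q] expresses the conormal and the normal interior
    of [C \/ Ker q] by inverse images along [q] inside the two parts. *)

From Stdlib Require Import ProofIrrelevance ClassicalEpsilon.
Require Import Defs.

Set Implicit Arguments.
Unset Strict Implicit.
Unset Printing Implicit Defensive.

(** * Heterogeneous equality of arrows *)

Lemma hom_eq_transport (C : category) (X Y X' Y' : C) (f : hom X Y)
    (g : hom X' Y') :
  hom_eq f g ->
  exists (p : X = X') (q : Y = Y'),
    eq_rect Y (fun V => hom X' V) (eq_rect X (fun U => hom U Y) f X' p) Y' q = g.
Proof. intros []; now exists eq_refl, eq_refl. Qed.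

(** Proof irrelevance turns both endpoint equations into [eq_refl], so the transport disappears. *)
Lemma hom_eq_eq (C : category) (X Y : C) (f g : hom X Y) : hom_eq f g -> f = g.
Proof.
intros H; destruct (hom_eq_transport H) as (p & q & E).
now rewrite (proof_irrelevance _ p eq_refl), (proof_irrelevance _ q eq_refl) in E.
Qed.

Lemma hom_eq_sym (C : category) (X Y X' Y' : C) (f : hom X Y) (g : hom X' Y') :
  hom_eq f g -> hom_eq g f.
Proof. intros []; constructor. Qed.

Lemma hom_eq_trans (C : category) (X Y X' Y' X'' Y'' : C)
    (f : hom X Y) (g : hom X' Y') (h : hom X'' Y'') :
  hom_eq f g -> hom_eq g h -> hom_eq f h.
Proof. now intros []. Qed.

Lemma hom_eq_comp (C : category) (X Y Z X' Y' Z' : C)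
    (f : hom X Y) (g : hom Y Z) (f' : hom X' Y') (g' : hom Y' Z') :
  hom_eq f f' -> hom_eq g g' -> hom_eq (g ∘ f) (g' ∘ f').
Proof.
intros Hf Hg.
destruct (hom_eq_transport Hf) as (p & q & E), (hom_eq_transport Hg) as (q' & r & E').
subst X' Y' Z'; rewrite (proof_irrelevance _ q' eq_refl) in E'.
simpl in E, E'; subst f' g'; constructor.
Qed.

Lemma hom_eq_idm (C : category) (X X' : C) : X = X' -> hom_eq (idm X) (idm X').
Proof. intros []; constructor. Qed.

Lemma form_faithful_hom_eq (C : category) (F : form C) (A B A' B' : dom F)
    (h : hom A B) (h' : hom A' B') :
  A = A' -> B = B' -> hom_eq (fmap F h) (fmap F h') -> hom_eq h h'.
Proof.
intros EA EB H; destruct EA, EB.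
rewrite (form_faithful (hom_eq_eq H)); constructor.
Qed.

(** * The relations between clusters *)

Lemma geq_comp (C : category) (F : form C) (X Y Z : C) (f : hom X Y) (g : hom Y Z)
    (A : cluster F X) (B : cluster F Y) (D : cluster F Z) :
  D >=[ g ] B -> B >=[ f ] A -> D >=[ g ∘ f ] A.
Proof.
intros [h Hh] [h' Hh']; exists (h ∘ h').
rewrite fmap_comp; now apply hom_eq_comp.
Qed.

Lemma ge_refl (C : category) (F : form C) (X : C) (A : cluster F X) : ge A A.
Proof.
exists (idm (cl_ob A)); rewrite fmap_id; apply hom_eq_idm; exact (cl_over A).
Qed.

Lemma ge_geq (C : category) (F : form C) (X Y : C) (f : hom X Y)
    (A : cluster F X) (B D : cluster F Y) :
  ge D B -> B >=[ f ] A -> D >=[ f ] A.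
Proof. intros H H'; rewrite <- (comp_idl f); exact (geq_comp H H'). Qed.

Lemma geq_ge (C : category) (F : form C) (X Y : C) (f : hom X Y)
    (A B : cluster F X) (D : cluster F Y) :
  D >=[ f ] B -> ge B A -> D >=[ f ] A.
Proof. intros H H'; rewrite <- (comp_idr f); exact (geq_comp H H'). Qed.

Lemma ge_trans (C : category) (F : form C) (X : C) (A B D : cluster F X) :
  ge D B -> ge B A -> ge D A.
Proof. exact (@ge_geq C F X X (idm X) A B D). Qed.

Lemma is_identity_hom_eq (C : category) (X Y Z : C) (f : hom X Y) :
  hom_eq (idm Z) f -> is_identity f.
Proof. intros []; constructor. Qed.

(** Faithfulness makes the two witnesses mutually inverse, as both lie over an identity. Amnesticity
    then makes [h] an identity, so its endpoints agree. *)
Lemma ge_antisym (C : category) (F : form C) (X : C) (A B : cluster F X) :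
  ge A B -> ge B A -> A = B.
Proof.
intros HAB HBA.
destruct HAB as [g Hg], HBA as [h Hh].
assert (inv : forall (S T : cluster F X) (u : hom (cl_ob S) (cl_ob T))
    (v : hom (cl_ob T) (cl_ob S)),
    hom_eq (fmap F u) (idm X) -> hom_eq (fmap F v) (idm X) ->
    v ∘ u = idm (cl_ob S)).
{ intros S T u v Hu Hv; apply form_faithful, hom_eq_eq.
  rewrite fmap_comp, fmap_id.
  apply (@hom_eq_trans _ _ _ _ _ _ _ _ (idm X ∘ idm X) _).
  - now apply hom_eq_comp.
  - rewrite comp_idl; apply hom_eq_idm; symmetry; apply cl_over. }
apply cluster_eq.
assert (I : is_identity h).
{ apply form_amnestic; [exists g; split; now apply inv |].
  apply (is_identity_hom_eq (hom_eq_sym Hh)). }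
now destruct I.
Qed.

Definition monotone (C : category) (F G : form C)
    (a : forall X, cluster F X -> cluster G X) : Prop :=
  forall X Y (f : hom X Y) (B : cluster F Y) (A : cluster F X),
    B >=[ f ] A -> a Y B >=[ f ] a X A.

Lemma op_cl_monotone (C : category) (F G : form C) (t : operator F G) :
  monotone (fun X => @op_cl C F G t X).
Proof.
intros X Y f B A [h Hh]; exists (fmap t h).
exact (hom_eq_trans (proj2 (op_over t) _ _ h) Hh).
Qed.

(** * Operators as monotone families of cluster maps *)

Section OperatorOfMonotone.
Variables (C : category) (F G : form C) (a : forall X, cluster F X -> cluster G X).
Hypothesis a_mono : monotone a.

Definition map_ob (A : dom F) : dom G := cl_ob (a (Cluster A eq_refl)).

Lemma map_hom_exists (A B : dom F) (h : hom A B) :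
  exists h' : hom (map_ob A) (map_ob B), hom_eq (fmap G h') (fmap F h).
Proof.
apply (@a_mono (F A) (F B) (fmap F h) (Cluster B eq_refl) (Cluster A eq_refl)).
exists h; constructor.
Qed.

(** [geq] only asserts that a lift exists, so one is chosen; faithfulness makes it unique, whence
    functoriality. *)
Definition map_hom (A B : dom F) (h : hom A B) : hom (map_ob A) (map_ob B) :=
  proj1_sig (constructive_indefinite_description _ (map_hom_exists h)).

Lemma map_hom_over (A B : dom F) (h : hom A B) :
  hom_eq (fmap G (map_hom h)) (fmap F h).
Proof. exact (proj2_sig (constructive_indefinite_description _ (map_hom_exists h))). Qed.

Lemma map_hom_id (A : dom F) : map_hom (idm A) = idm (map_ob A).
Proof.
apply form_faithful, hom_eq_eq, (hom_eq_trans (map_hom_over _)).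
rewrite !fmap_id; apply hom_eq_idm; symmetry.
exact (cl_over (a (Cluster A eq_refl))).
Qed.

Lemma map_hom_comp (A B D : dom F) (g : hom B D) (f : hom A B) :
  map_hom (g ∘ f) = map_hom g ∘ map_hom f.
Proof.
apply form_faithful, hom_eq_eq, (hom_eq_trans (map_hom_over _)), hom_eq_sym.
rewrite !fmap_comp; apply hom_eq_comp; apply map_hom_over.
Qed.

Definition map_functor : functor (dom F) (dom G) := Functor map_hom_id map_hom_comp.

Lemma map_functor_over : functor_eq (functor_comp G map_functor) F.
Proof.
split; [intros A; exact (cl_over (a (Cluster A eq_refl))) |].
intros A B h; apply map_hom_over.
Qed.

Definition map_operator : operator F G := Operator map_functor_over.

Lemma map_ob_cl (X : C) (S : cluster F X) : map_ob (cl_ob S) = cl_ob (a S).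
Proof. now destruct S as [A []]. Qed.

End OperatorOfMonotone.

Definition cluster_iso (C : category) (F G : form C)
    (a : forall X, cluster F X -> cluster G X)
    (b : forall X, cluster G X -> cluster F X) : Prop :=
  monotone a /\ monotone b /\
  (forall X S, b X (a X S) = S) /\ (forall X T, a X (b X T) = T).

Lemma map_functor_cancel (C : category) (F G : form C)
    (a : forall X, cluster F X -> cluster G X)
    (b : forall X, cluster G X -> cluster F X)
    (Ha : monotone a) (Hb : monotone b) :
  (forall X S, b X (a X S) = S) ->
  functor_eq (functor_comp (map_functor Hb) (map_functor Ha)) (functor_id (dom F)).
Proof.
intros ba.
assert (ob_eq : forall A : dom F, map_ob b (map_ob a A) = A).
{ intros A; unfold map_ob at 2; now rewrite map_ob_cl, ba. }
split; [exact ob_eq |]; intros A B h.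
apply form_faithful_hom_eq; [apply ob_eq | apply ob_eq |].
exact (hom_eq_trans (map_hom_over Hb _) (map_hom_over Ha _)).
Qed.

Lemma op_cl_cancel (C : category) (F G : form C) (s : operator F G)
    (t : operator G F) :
  functor_eq (functor_comp t s) (functor_id (dom F)) ->
  forall X (S : cluster F X), op_cl t (op_cl s S) = S.
Proof. intros H X S; apply cluster_eq; exact (proj1 H (cl_ob S)). Qed.

(** Replaces functors by maps of clusters, the language of all later arguments. *)
Lemma isomorphic_formsP (C : category) (F G : form C) :
  isomorphic_forms F G <-> exists a b, @cluster_iso C F G a b.
Proof.
split.
- intros (s & t & ts & st).
  exists (fun X => @op_cl C F G s X), (fun X => @op_cl C G F t X).
  repeat split; try apply op_cl_monotone; now apply op_cl_cancel.
- intros (a & b & Ha & Hb & ba & ab).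
  exists (map_operator Ha), (map_operator Hb).
  split; now apply map_functor_cancel.
Qed.

Lemma cluster_iso_sym (C : category) (F G : form C) a b :
  @cluster_iso C F G a b -> cluster_iso b a.
Proof. intros (? & ? & ? & ?); now repeat split. Qed.

(** * Clusters of a subform *)

Section SubformClusters.
Variables (C : category) (F : form C) (P : forall X, cluster F X -> Prop).

Lemma in_subform_cl X (S : cluster F X) : P S -> in_subform P (cl_ob S).
Proof. now destruct S as [A []]. Qed.

Definition sub_cl X (S : cluster F X) (p : P S) : cluster (subform P) X :=
  @Cluster C (subform P) X (exist _ (cl_ob S) (in_subform_cl p)) (cl_over S).

Definition sub_val X (S : cluster (subform P) X) : cluster F X :=
  op_cl (subform_incl P) S.

Lemma sub_valP X (S : cluster (subform P) X) : P (sub_val S).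
Proof.
destruct S as [[A p] e]; destruct e.
replace (sub_val _) with (Cluster (F := F) A eq_refl) by now apply cluster_eq.
exact p.
Qed.

Lemma sub_val_cl X (S : cluster F X) (p : P S) : sub_val (sub_cl p) = S.
Proof. now apply cluster_eq. Qed.

Lemma sub_val_inj X (S T : cluster (subform P) X) : sub_val S = sub_val T -> S = T.
Proof.
intros H; apply cluster_eq.
apply (f_equal (@cl_ob _ _ _)) in H.
destruct (cl_ob S) as [A p] eqn:ES, (cl_ob T) as [B q] eqn:ET.
simpl in H; rewrite ES, ET in H; simpl in H; subst B.
now rewrite (proof_irrelevance _ p q).
Qed.

Lemma sub_val_geq X Y (f : hom X Y) (B : cluster (subform P) Y)
    (A : cluster (subform P) X) :
  sub_val B >=[ f ] sub_val A <-> B >=[ f ] A.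
Proof. reflexivity. Qed.

Lemma sub_val_ext X (S T : cluster F X) (p : P S) (q : P T) :
  S = T -> sub_cl p = sub_cl q.
Proof. intros E; apply sub_val_inj; now rewrite !sub_val_cl. Qed.

End SubformClusters.

Lemma cluster_iso_subform (C : category) (F G : form C)
    (P : forall X, cluster F X -> Prop) (Q : forall X, cluster G X -> Prop) a b :
  @cluster_iso C F G a b ->
  (forall X (S : cluster F X), P X S -> Q X (a X S)) ->
  (forall X (T : cluster G X), Q X T -> P X (b X T)) ->
  isomorphic_forms (subform P) (subform Q).
Proof.
intros (Ha & Hb & ba & ab) PQ QP; apply isomorphic_formsP.
exists (fun X S => sub_cl (PQ X _ (sub_valP S))),
  (fun X T => sub_cl (QP X _ (sub_valP T))).
repeat split.
- intros X Y f B A HBA; apply (proj1 (sub_val_geq _ _ _)); rewrite !sub_val_cl.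
  apply Ha, (proj2 (sub_val_geq _ _ _)), HBA.
- intros X Y f B A HBA; apply (proj1 (sub_val_geq _ _ _)); rewrite !sub_val_cl.
  apply Hb, (proj2 (sub_val_geq _ _ _)), HBA.
- intros X S; apply sub_val_inj; now rewrite !sub_val_cl.
- intros X T; apply sub_val_inj; now rewrite !sub_val_cl.
Qed.

(* An isomorphism between the images of two idempotents [k] and [l], given as
   total maps: [a] is the isomorphism precomposed with [k], [b] its inverse
   precomposed with [l]. *)
Record retract_iso (C : category) (F G : form C)
    (k : forall X, cluster F X -> cluster F X)
    (l : forall X, cluster G X -> cluster G X)
    (a : forall X, cluster F X -> cluster G X)
    (b : forall X, cluster G X -> cluster F X) : Prop := RetractIso {
  ri_mono : monotone a;
  ri_mono_inv : monotone b;
  ri_cancel : forall X S, b X (a X S) = k X S;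
  ri_cancel_inv : forall X T, a X (b X T) = l X T;
  ri_retract : forall X S, a X (k X S) = a X S;
  ri_retract_inv : forall X T, b X (l X T) = b X T
}.

Lemma retract_iso_sym (C : category) (F G : form C) k l a b :
  @retract_iso C F G k l a b -> retract_iso l k b a.
Proof. intros []; now constructor. Qed.

Lemma ri_fixed (C : category) (F G : form C) k l a b :
  @retract_iso C F G k l a b -> forall X S, l X (a X S) = a X S.
Proof.
intros H X S.
now rewrite <- (ri_cancel_inv H), (ri_cancel H), (ri_retract H).
Qed.

(** Precomposing with the retractions [k] and [l] extends the isomorphism to all clusters, so
    membership proofs drop out of later computations. *)
Lemma subform_retract_iso (C : category) (F G : form C)
    (P : forall X, cluster F X -> Prop) (Q : forall X, cluster G X -> Prop)
    (k : forall X, cluster F X -> cluster F X)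
    (l : forall X, cluster G X -> cluster G X) :
  monotone k -> (forall X S, P X (k X S)) -> (forall X S, P X S -> k X S = S) ->
  monotone l -> (forall X T, Q X (l X T)) -> (forall X T, Q X T -> l X T = T) ->
  isomorphic_forms (subform P) (subform Q) ->
  exists a b, retract_iso k l a b.
Proof.
intros k_mono Pk kP l_mono Ql lQ HPQ.
apply isomorphic_formsP in HPQ; destruct HPQ as (a & b & Ha & Hb & ba & ab).
exists (fun X S => sub_val (a X (sub_cl (Pk X S)))),
  (fun X T => sub_val (b X (sub_cl (Ql X T)))).
constructor.
- intros X Y f B A HBA.
  apply (proj2 (sub_val_geq _ _ _)), Ha, (proj1 (sub_val_geq _ _ _)).
  rewrite !sub_val_cl; now apply k_mono.
- intros X Y f B A HBA.
  apply (proj2 (sub_val_geq _ _ _)), Hb, (proj1 (sub_val_geq _ _ _)).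
  rewrite !sub_val_cl; now apply l_mono.
- intros X S.
  (* The value of [a] already satisfies [Q], so [l] fixes it. *)
  replace (sub_cl (Ql X _)) with (a X (sub_cl (Pk X S))).
  + now rewrite ba, sub_val_cl.
  + apply sub_val_inj; rewrite sub_val_cl; symmetry; apply lQ, sub_valP.
- intros X T.
  replace (sub_cl (Pk X _)) with (b X (sub_cl (Ql X T))).
  + now rewrite ab, sub_val_cl.
  + apply sub_val_inj; rewrite sub_val_cl; symmetry; apply kP, sub_valP.
- intros X S; do 2 f_equal; apply sub_val_ext; apply kP, Pk.
- intros X T; do 2 f_equal; apply sub_val_ext; apply lQ, Ql.
Qed.

(** * Images and kernels in orean forms *)

Section Orean.
Variables (C : category) (F : form C) (oF : orean F).

Lemma Im_geq X Y (f : hom X Y) : Im oF f >=[ f ] top oF X.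
Proof. apply dimg_geq. Qed.

Lemma Im_least X Y (f : hom X Y) (T : cluster F Y) :
  T >=[ f ] top oF X -> ge T (Im oF f).
Proof. apply dimg_least. Qed.

Lemma Ker_geq X Y (f : hom X Y) : bot oF Y >=[ f ] Ker oF f.
Proof. apply iimg_geq. Qed.

Lemma Ker_greatest X Y (f : hom X Y) (S : cluster F X) :
  bot oF Y >=[ f ] S -> ge (Ker oF f) S.
Proof. apply iimg_greatest. Qed.

Lemma Im_idm X : Im oF (idm X) = top oF X.
Proof. apply ge_antisym; [apply Im_geq | apply Im_least, ge_refl]. Qed.

Lemma Ker_idm X : Ker oF (idm X) = bot oF X.
Proof. apply ge_antisym; [apply Ker_greatest, ge_refl | apply Ker_geq]. Qed.

(** The inequality that is not formal is (O2): it splits the relation along [g ∘ f] at a cluster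
    [B], which lies above [Im f]. *)
Lemma dimg_Im X Y Z (f : hom X Y) (g : hom Y Z) :
  dimg oF g (Im oF f) = Im oF (g ∘ f).
Proof.
apply ge_antisym.
- apply Im_least; exact (geq_comp (dimg_geq oF g _) (Im_geq f)).
- apply dimg_least.
  destruct (geq_factor oF (Im_geq (g ∘ f))) as (B & HB & HB').
  exact (geq_ge HB (Im_least HB')).
Qed.

Lemma join_geq X Y (f : hom X Y) (T : cluster F Y) (S S' : cluster F X) :
  T >=[ f ] S -> T >=[ f ] S' -> T >=[ f ] join oF S S'.
Proof.
intros H H'; apply (geq_ge (iimg_geq oF f T)).
apply join_lub; now apply iimg_greatest.
Qed.

End Orean.

Lemma join_monotone (C : category) (F G : form C) (oG : orean G)
    (a b : forall X, cluster F X -> cluster G X) :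
  monotone a -> monotone b -> monotone (fun X S => join oG (a X S) (b X S)).
Proof.
intros Ha Hb X Y f B A HBA; apply join_geq.
- exact (ge_geq (join_ubl oG _ _) (Ha _ _ _ _ _ HBA)).
- exact (ge_geq (join_ubr oG _ _) (Hb _ _ _ _ _ HBA)).
Qed.

(* The consequences of an exact join decomposition that do not mention the
   orean structures of the two fixed forms.  In the last field, [ke top] is the
   top of the normal part, so the field says that [ke (Im f)] is below the image
   of [f] computed there. *)
Record interior_decomposition (C : category) (F : form C) (oF : orean F)
    (ks ke : forall X, cluster F X -> cluster F X) : Prop := InteriorDecomposition {
  id_ks_mono : monotone ks;
  id_ke_mono : monotone ke;
  id_ks_conormal : forall X S, is_conormal oF (ks X S);
  id_ke_normal : forall X S, is_normal oF (ke X S);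
  id_ks_fix : forall X S, is_conormal oF S -> ks X S = S;
  id_ke_fix : forall X S, is_normal oF S -> ke X S = S;
  id_join : forall X S, join oF (ks X S) (ke X S) = S;
  id_ke_Im : forall X Y (f : hom X Y) (N : cluster F Y),
    is_normal oF N -> N >=[ f ] ke X (top oF X) -> ge N (ke Y (Im oF f))
}.

(** * From exact join decompositions to interior operators *)

Lemma sub_val_corestr (C : category) (F : form C) (k : operator F F)
    (Hk : idempotent_op k) X (S : cluster F X) :
  sub_val (op_cl (fixed_corestr Hk) S) = op_cl k S.
Proof. now apply cluster_eq. Qed.

Lemma exact_interior_decomposition (C : category) (F : form C) (oF : orean F)
    (D : join_decomposition oF) :
  exact D ->
  interior_decomposition oF (fun X => @op_cl C F F (kappa_s D) X)
    (fun X => @op_cl C F F (kappa_e D) X).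
Proof.
intros [[tau_s _] [tau_e tau_e'] _ _ incl_s incl_e].
assert (tau_s_Im : forall X Y (f : hom X Y),
    op_cl (kappa_s D) (Im oF f) = sub_val (Im (orean_s D) f)).
{ intros X Y f; now rewrite <- tau_s, sub_val_corestr. }
assert (tau_e_Ker : forall X Y (f : hom X Y),
    op_cl (kappa_e D) (Ker oF f) = sub_val (Ker (orean_e D) f)).
{ intros X Y f; now rewrite <- tau_e', sub_val_corestr. }
constructor.
- apply op_cl_monotone.
- apply op_cl_monotone.
- intros X S.
  (* The value is an image in the fixed form, and the conormal inclusion carries it to an image in
     [F]. *)
  destruct (conormal_s (op_cl (fixed_corestr (idem_s D)) S)) as (W & f & Hf).
  exists W, f; rewrite <- incl_s, Hf; apply sub_val_corestr.
- intros X S.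
  destruct (normal_e (op_cl (fixed_corestr (idem_e D)) S)) as (W & f & Hf).
  exists W, f; rewrite <- incl_e, Hf; apply sub_val_corestr.
- intros X S (W & f & <-); rewrite tau_s_Im; apply incl_s.
- intros X S (W & f & <-); rewrite tau_e_Ker; apply incl_e.
- intros X S; symmetry; apply join_decomp.
- intros X Y f N (W & g & <-) HN.
  (* Being fixed, [N] is a cluster of the fixed form, where [kappa_e] of [Im f] is the image of [f];
     leastness of that image applies there. *)
  assert (fix_N : op_cl (kappa_e D) (Ker oF g) = Ker oF g).
  { rewrite tau_e_Ker; apply incl_e. }
  rewrite <- sub_val_corestr with (Hk := idem_e D), tau_e.
  rewrite <- (sub_val_cl
    (P := fun X (S : cluster F X) => op_cl (kappa_e D) S = S) fix_N).
  apply (proj2 (sub_val_geq _ _ _)), Im_least, (proj1 (sub_val_geq _ _ _)).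
  rewrite sub_val_cl.
  apply (geq_ge HN).
  (* The top of the fixed form is its own [kappa_e], hence lies below [kappa_e] of the top of
     [F]. *)
  apply (@ge_trans _ _ _ _ (op_cl (kappa_e D) (sub_val (top (orean_e D) X)))).
  + apply op_cl_monotone, top_greatest.
  + rewrite (sub_valP (top (orean_e D) X)); apply ge_refl.
Qed.

Section Interior.
Variables (C : category) (F : form C) (oF : orean F)
  (ks ke : forall X, cluster F X -> cluster F X).
Hypothesis dF : interior_decomposition oF ks ke.

Lemma ke_le X (S : cluster F X) : ge S (ke S).
Proof. rewrite <- (id_join dF S) at 1; apply join_ubr. Qed.

Lemma ks_Im X Y (f : hom X Y) : ks (Im oF f) = Im oF f.
Proof. apply (id_ks_fix dF); now exists X, f. Qed.

Lemma ks_top X : ks (top oF X) = top oF X.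
Proof. rewrite <- Im_idm; apply ks_Im. Qed.

Lemma ke_Ker X Y (f : hom X Y) : ke (Ker oF f) = Ker oF f.
Proof. apply (id_ke_fix dF); now exists Y, f. Qed.

Lemma ke_bot X : ke (bot oF X) = bot oF X.
Proof. rewrite <- Ker_idm; apply ke_Ker. Qed.

End Interior.

(** * Gluing the isomorphisms of the two parts *)

Section Compare.
Variables (C : category) (F G : form C) (oF : orean F) (oG : orean G)
  (ks ke : forall X, cluster F X -> cluster F X)
  (ls le : forall X, cluster G X -> cluster G X)
  (a b : forall X, cluster F X -> cluster G X)
  (a' b' : forall X, cluster G X -> cluster F X).
Hypotheses (dG : interior_decomposition oG ls le)
  (Ha : retract_iso ks ls a a') (Hb : retract_iso ke le b b').

(** The top of [G] is conormal, so it equals [a (a' top)] and lies below [a top]; monotonicity along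
    [f] does the rest. *)
Lemma conormal_iso_Im_ge X Y (f : hom X Y) : ge (a (Im oF f)) (Im oG f).
Proof.
apply Im_least, (@geq_ge _ _ _ _ _ _ (a (top oF X))).
- apply (ri_mono Ha), Im_geq.
- rewrite <- (ks_top dG), <- (ri_cancel_inv Ha).
  apply (ri_mono Ha), top_greatest.
Qed.

Lemma normal_iso_Ker_le X Y (f : hom X Y) : ge (Ker oG f) (b (Ker oF f)).
Proof.
apply Ker_greatest, (@ge_geq _ _ _ _ _ _ (b (bot oF Y))).
- rewrite <- (ke_bot dG), <- (ri_cancel_inv Hb).
  apply (ri_mono Hb), bot_least.
- apply (ri_mono Hb), Ker_geq.
Qed.

(** Tops need only be compared inside the normal parts: [le top = b (b' top)] lies below [b top],
    and [id_ke_Im] gives leastness among normal clusters. *)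
Lemma normal_iso_Im_ge X Y (f : hom X Y) :
  ge (b (Im oF f)) (le (Im oG f)).
Proof.
apply (id_ke_Im dG).
- rewrite <- (ri_fixed Hb); apply (id_ke_normal dG).
- apply (@geq_ge _ _ _ _ _ _ (b (top oF X))).
  + apply (ri_mono Hb), Im_geq.
  + rewrite <- (ri_cancel_inv Hb); apply (ri_mono Hb), top_greatest.
Qed.

End Compare.

Section Glue.
Variables (C : category) (F G : form C) (oF : orean F) (oG : orean G)
  (ks ke : forall X, cluster F X -> cluster F X)
  (ls le : forall X, cluster G X -> cluster G X)
  (a b : forall X, cluster F X -> cluster G X)
  (a' b' : forall X, cluster G X -> cluster F X).
Hypotheses (nF : noetherian oF) (nG : noetherian oG)
  (dF : interior_decomposition oF ks ke)
  (dG : interior_decomposition oG ls le)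
  (Ha : retract_iso ks ls a a') (Hb : retract_iso ke le b b').

(** One inequality is the comparison for the inverse isomorphism; the other is [a'] applied to the
    comparison for [a]. *)
Lemma conormal_iso_Im X Y (f : hom X Y) : a' (Im oG f) = Im oF f.
Proof.
apply ge_antisym.
- apply (conormal_iso_Im_ge oG dF (retract_iso_sym Ha)).
- rewrite <- (ks_Im dF), <- (ri_cancel Ha).
  apply (ri_mono_inv Ha), (conormal_iso_Im_ge oF dG Ha).
Qed.

Lemma normal_iso_Ker X Y (f : hom X Y) : b (Ker oF f) = Ker oG f.
Proof.
apply ge_antisym; [| apply (normal_iso_Ker_le oF dG Hb)].
rewrite <- (ke_Ker dG), <- (ri_cancel_inv Hb).
apply (ri_mono Hb), (normal_iso_Ker_le oG dF (retract_iso_sym Hb)).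
Qed.

(** This links the two isomorphisms: [b'], which is defined through kernels, is still controlled on
    images. *)
Lemma normal_iso_Im_le X Y (f : hom X Y) : ge (Im oF f) (b' (Im oG f)).
Proof.
apply (ge_trans (ke_le dF _)).
rewrite <- (ri_cancel Hb), <- (ri_retract_inv Hb (Im oG f)).
apply (ri_mono_inv Hb), (normal_iso_Im_ge oF dG Hb).
Qed.

(* With [ke S = Ker q] and [ks S = Im m], both [join (a S) (b S)] and [S] are
   inverse images along [q] of the image of [q ∘ m]. *)
Lemma glue_witness X (S : cluster F X) :
  exists (Y W : C) (q : hom X Y) (m : hom W X),
    S = iimg oF (Im oF (q ∘ m)) q /\
    join oG (a S) (b S) = iimg oG (Im oG (q ∘ m)) q.
Proof.
destruct (id_ke_normal dF S) as (Y & q & Hq).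
assert (Hc : is_conormal oG (a S)).
{ rewrite <- (ri_fixed Ha); apply (id_ks_conormal dG). }
destruct Hc as (W & m & Hm).
exists Y, W, q, m; split.
- rewrite <- dimg_Im, (noeth_iimg_dimg nF), Hq, <- conormal_iso_Im, Hm.
  now rewrite (ri_cancel Ha), (id_join dF).
- rewrite <- dimg_Im, (noeth_iimg_dimg nG), Hm.
  now rewrite <- (ri_retract Hb), <- Hq, normal_iso_Ker.
Qed.

Lemma ls_glue X (S : cluster F X) : ls (join oG (a S) (b S)) = a S.
Proof.
apply ge_antisym.
- rewrite <- (ri_fixed Ha) at 2; apply (id_ks_mono dG), join_ubl.
(* It suffices that [S] lies above [a'] of the glued cluster. Since [S] is itself an inverse image
   along [q], this becomes a relation along [q], which [a'] preserves together with images. *)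
- destruct (glue_witness S) as (Y & W & q & m & HS & ->).
  rewrite <- (ri_cancel_inv Ha); apply (ri_mono Ha).
  rewrite HS at 1; apply iimg_greatest; rewrite <- conormal_iso_Im.
  apply (ri_mono_inv Ha), iimg_geq.
Qed.

Lemma le_glue X (S : cluster F X) : le (join oG (a S) (b S)) = b S.
Proof.
apply ge_antisym.
- rewrite <- (ri_fixed Hb) at 2; apply (id_ke_mono dG), join_ubr.
(* The same reduction for [b'], where the inequality [normal_iso_Im_le] replaces preservation of
   images. *)
- destruct (glue_witness S) as (Y & W & q & m & HS & ->).
  rewrite <- (ri_cancel_inv Hb); apply (ri_mono Hb).
  rewrite HS at 1; apply iimg_greatest, (ge_geq (normal_iso_Im_le _)).
  apply (ri_mono_inv Hb), iimg_geq.
Qed.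

(** [a'] and [b'] depend only on the interiors [ls] and [le] of their argument, which are [a S] and
    [b S]. *)
Lemma glue_cancel X (S : cluster F X) :
  join oF (a' (join oG (a S) (b S))) (b' (join oG (a S) (b S))) = S.
Proof.
rewrite <- (ri_retract_inv Ha), <- (ri_retract_inv Hb), ls_glue, le_glue.
now rewrite (ri_cancel Ha), (ri_cancel Hb), (id_join dF).
Qed.

End Glue.

(** * Isomorphisms of forms preserve images and kernels *)

Section PreserveParts.
Variables (C : category) (F G : form C) (oF : orean F) (oG : orean G)
  (a : forall X, cluster F X -> cluster G X)
  (b : forall X, cluster G X -> cluster F X).
Hypothesis ab : cluster_iso a b.

Lemma cluster_iso_Im X Y (f : hom X Y) : a (Im oF f) = Im oG f.
Proof.
destruct ab as (Ha & Hb & ba_id & ab_id).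
apply ge_antisym.
- apply Im_least, (geq_ge (Ha _ _ _ _ _ (Im_geq oF f))).
  rewrite <- (ab_id _ (top oG X)); apply Ha, top_greatest.
- rewrite <- (ab_id _ (Im oG f)); apply Ha, Im_least.
  apply (geq_ge (Hb _ _ _ _ _ (Im_geq oG f))).
  rewrite <- (ba_id _ (top oF X)); apply Hb, top_greatest.
Qed.

Lemma cluster_iso_Ker X Y (f : hom X Y) : a (Ker oF f) = Ker oG f.
Proof.
destruct ab as (Ha & Hb & ba_id & ab_id).
apply ge_antisym.
- rewrite <- (ab_id _ (Ker oG f)); apply Ha, Ker_greatest.
  refine (ge_geq _ (Hb _ _ _ _ _ (Ker_geq oG f))).
  rewrite <- (ba_id _ (bot oF Y)); apply Hb, bot_least.
- apply Ker_greatest.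
  refine (ge_geq _ (Ha _ _ _ _ _ (Ker_geq oF f))).
  rewrite <- (ab_id _ (bot oG Y)); apply Ha, bot_least.
Qed.

Lemma cluster_iso_conormal X (S : cluster F X) :
  is_conormal oF S -> is_conormal oG (a S).
Proof. intros (W & f & <-); exists W, f; now rewrite cluster_iso_Im. Qed.

Lemma cluster_iso_normal X (S : cluster F X) :
  is_normal oF S -> is_normal oG (a S).
Proof. intros (Y & f & <-); exists Y, f; now rewrite cluster_iso_Ker. Qed.

End PreserveParts.

Theorem theorem160 (C : category) (F G : form C) (oF : orean F) (oG : orean G)
    (nF : noetherian oF) (nG : noetherian oG)
    (dF : has_exact_join_decomposition oF)
    (dG : has_exact_join_decomposition oG) :
  (isomorphic_forms (conormal_part oF) (conormal_part oG) /\
   isomorphic_forms (normal_part oF) (normal_part oG)) <->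
  isomorphic_forms F G.
Proof.
split.
- intros [Hc Hn].
  destruct dF as [DF EF], dG as [DG EG].
  apply exact_interior_decomposition in EF, EG.
  (* The interior operators serve as the retractions onto the conormal and normal parts. *)
  destruct (subform_retract_iso (id_ks_mono EF) (id_ks_conormal EF) (id_ks_fix EF)
    (id_ks_mono EG) (id_ks_conormal EG) (id_ks_fix EG) Hc) as (a & a' & Ha).
  destruct (subform_retract_iso (id_ke_mono EF) (id_ke_normal EF) (id_ke_fix EF)
    (id_ke_mono EG) (id_ke_normal EG) (id_ke_fix EG) Hn) as (b & b' & Hb).
  apply isomorphic_formsP.
  exists (fun X S => join oG (a X S) (b X S)), (fun X T => join oF (a' X T) (b' X T)).
  repeat split.
  + exact (join_monotone oG (ri_mono Ha) (ri_mono Hb)).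
  + exact (join_monotone oF (ri_mono_inv Ha) (ri_mono_inv Hb)).
  + exact (glue_cancel nF nG EF EG Ha Hb).
  + exact (glue_cancel nG nF EG EF (retract_iso_sym Ha) (retract_iso_sym Hb)).
- intros H; apply isomorphic_formsP in H; destruct H as (a & b & ab).
  pose proof (cluster_iso_sym ab) as ba.
  split; apply (cluster_iso_subform ab).
  + exact (cluster_iso_conormal oG ab).
  + exact (cluster_iso_conormal oF ba).
  + exact (cluster_iso_normal oG ab).
  + exact (cluster_iso_normal oF ba).
Qed.
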